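(* Let $\gamma\subseteq\mathbb P^2$ be an irreducible conic and let $X=\mathbb S(\ell_1,\ldots,\ell_r)$ and $Y=\mathbb S(m_1,\ldots,m_s)$ be two contact star configurations on $\gamma$, with $r,s\ge2$ and the $r+s$ tangent lines $\ell_1,\ldots,\ell_r,m_1,\ldots,m_s$ distinct. Let $P,Q$ be two distinct points in $\mathbb P^2$. Then $$h_{X\cup Y}=h_{(r-1)P+(s-1)Q}.$$
   Context: Work over $\mathbb C$ with $S=\mathbb C[x,y,z]=\mathbb C[\mathbb P^2]$. A set of $r\ge2$ lines in $\mathbb P^2$ meets properly if the lines are distinct and no three of them are concurrent; the star configuration $\mathbb S(\ell_1,\ldots,\ell_r)$ defined by such lines is the set of the $\binom r2$ points $\ell_i\cap\ell_j$, $i<j$. A contact star configuration on an irreducible conic $\gamma$ is a star configuration $\mathbb S(\ell_1,\ldots,\ell_r)$ where $\ell_1,\ldots,\ell_r$ are the tangent lines to $\gamma$ at $r$ distinct points of $\gamma$ (such lines always meet properly). For a zero-dimensional scheme $X\subseteq\mathbb P^2$ with saturated homogeneous ideal $I_X$ (for a finite set of points, the ideal of all forms vanishing on it), the Hilbert function is $H_X(t)=\dim S_t-\dim(I_X)_t$ and the $h$-vector is its first difference $h_X(t)=H_X(t)-H_X(t-1)$, with $H_X(-1)=0$. For distinct points $P,Q$ and positive integers $m,n$, the scheme of fat points $mP+nQ$ is defined by the ideal $I_P^m\cap I_Q^n$. *)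

(* Defs.v *)
From HB Require Import structures.
From mathcomp Require Import all_boot all_order all_algebra.
From mathcomp Require Import mpoly boolp classical_sets.

Set Implicit Arguments.
Unset Strict Implicit.
Unset Printing Implicit Defensive.

Import Order.TTheory GRing.Theory Num.Theory.

Local Open Scope classical_set_scope.
Local Open Scope ring_scope.

Section LinearSubspaces.
Variables (K : fieldType) (V : vectType K).

(* The set A viewed as an element of {vspace V}. This is meaningful only when
   A is a linear subspace, see vspace_ofP; the value is 0 otherwise. *)
Definition vspace_of (A : set V) : {vspace V} :=
  xget 0%VS [set U : {vspace V} | forall v, v \in U <-> A v].

Lemma vspace_ofP (A : set V) :
  A 0 -> (forall a u v, A u -> A v -> A (a *: u + v)) ->
  forall v, v \in vspace_of A <-> A v.
Proof.
move=> A0 Alin; rewrite /vspace_of.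
case: xgetP => [_ -> //|noU]; exfalso.
pose p n := `[< exists U : {vspace V},
  (forall v, v \in U -> A v) /\ \dim U = n >].
have ep : exists n, p n.
  exists 0%N; apply/asboolP; exists 0%VS; split; last exact: dimv0.
  by move=> v; rewrite memv0 => /eqP ->.
have pb n : p n -> (n <= \dim {:V})%N.
  by move/asboolP=> [U [_ <-]]; rewrite dimvS // subvf.
case: (ex_maxnP ep pb) => n /asboolP [U [UA dU]] maxU.
apply: (noU U) => v; split; first exact: UA.
move=> Av; have WA w : w \in (<[v]> + U)%VS -> A w.
  by case/memv_addP => _ /vlineP [a ->] [u /UA Au ->]; apply: Alin.
have : p (\dim (<[v]> + U)%VS) by apply/asboolP; exists (<[v]> + U)%VS.
move/maxU; rewrite -dU => le_d.
have /eqP -> : U == (<[v]> + U)%VS by rewrite eqEdim addvSr le_d.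
by rewrite (subvP (addvSl _ _)) // memv_line.
Qed.

End LinearSubspaces.

Section Ideals.
Variable A : comNzRingType.

Definition is_ideal (I : set A) : Prop :=
  [/\ I 0, forall f g, I f -> I g -> I (f + g) & forall h f, I f -> I (h * f)].

Definition ideal_gen (G : set A) : set A :=
  [set f | exists n (h g : 'I_n -> A),
     (forall i, G (g i)) /\ f = \sum_(i < n) h i * g i].

Definition ideal_pow (I : set A) (m : nat) : set A :=
  ideal_gen [set f | exists g : 'I_m -> A,
     (forall i, I (g i)) /\ f = \prod_(i < m) g i].

Lemma is_ideal_gen (G : set A) : is_ideal (ideal_gen G).
Proof.
split.
- exists 0%N, (fun=> 0), (fun=> 0); split; first by case.
  by rewrite big_ord0.
- move=> f g [n [h [k [Gk ->]]]] [n' [h' [k' [Gk' ->]]]].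
  exists (n + n')%N.
  exists (fun i => match split i with inl j => h j | inr j => h' j end).
  exists (fun i => match split i with inl j => k j | inr j => k' j end).
  split; first by move=> i; case: (split i).
  rewrite big_split_ord; congr (_ + _); apply: eq_bigr => i _.
    by rewrite (unsplitK (inl i : 'I_n + 'I_n')).
  by rewrite (unsplitK (inr i : 'I_n + 'I_n')).
- move=> h f [n [k [g [Gg ->]]]]; exists n, (fun i => h * k i), g; split=> //.
  by rewrite mulr_sumr; apply: eq_bigr => i _; rewrite mulrA.
Qed.

Lemma is_idealI (I J : set A) :
  is_ideal I -> is_ideal J -> is_ideal (I `&` J).
Proof.
case=> I0 ID IM [J0 JD JM]; split=> //.
- by move=> f g [If Jf] [Ig Jg]; split; [apply: ID|apply: JD].
- by move=> h f [If Jf]; split; [apply: IM|apply: JM].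
Qed.

End Ideals.

Definition irreducible (B : idomainType) (f : B) : Prop :=
  [/\ f != 0, f \isn't a GRing.unit &
      forall g h, f = g * h -> g \is a GRing.unit \/ h \is a GRing.unit].

Section ProjectivePlane.
Variable K : fieldType.
Local Notation S := {mpoly K[3]}.

(* Points and lines of P^2 are the subspaces of K^3 of dimension 1 and 2. *)
Definition ppoint := {U : {vspace 'rV[K]_3} | \dim U == 1%N}.
Definition pline := {U : {vspace 'rV[K]_3} | \dim U == 2%N}.

(* For a form f this does not depend on the representatives of P; for f a
   constant form, it says that f = 0. *)
Definition vanishes_at (f : S) (P : ppoint) : Prop :=
  forall v : 'rV[K]_3, v \in val P -> f.@[v 0] = 0.

Definition point_ideal (X : set ppoint) : set S :=
  ideal_gen [set f | exists d : nat,
     f \is d.-homog /\ forall P, X P -> vanishes_at f P].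

Definition fat2_ideal (m : nat) (P : ppoint) (n : nat) (Q : ppoint) : set S :=
  ideal_pow (point_ideal [set P]) m `&` ideal_pow (point_ideal [set Q]) n.

Definition graded_piece (I : set S) (t : nat) : {vspace dhomog 3 K t} :=
  vspace_of [set f : dhomog 3 K t | I (f : S)].

Lemma graded_pieceP (I : set S) (t : nat) : is_ideal I ->
  forall f : dhomog 3 K t, f \in graded_piece I t <-> I (f : S).
Proof.
case=> I0 ID IM; apply: vspace_ofP => //.
move=> a u v Iu Iv /=.
suff: I (a *: (u : S) + (v : S)) by [].
apply: (ID _ _ _ Iv); rewrite -mul_mpolyC; exact: (IM _ _ Iu).
Qed.

Definition hilbert_function (I : set S) (t : nat) : int :=
  (\dim {:dhomog 3 K t})%:Z - (\dim (graded_piece I t))%:Z.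

Definition h_vector (I : set S) (t : nat) : int :=
  hilbert_function I t - (if t is u.+1 then hilbert_function I u else 0).

Definition star_configuration (r : nat) (l : 'I_r -> pline) : set ppoint :=
  [set P | exists i j : 'I_r,
     (i < j)%N /\ val P = (val (l i) :&: val (l j))%VS].

Definition irreducible_conic_form (F : S) : Prop :=
  F \is 2.-homog /\ irreducible F.

Definition tangent_line (F : S) (P : ppoint) (l : pline) : Prop :=
  vanishes_at F P /\
  forall u : 'rV[K]_3, u \in val P -> u != 0 ->
  forall v : 'rV[K]_3,
    v \in val l <-> \sum_(i < 3) (F^`M(i)).@[u 0] * v 0 i = 0.

(* For F an irreducible conic form over the complex numbers, such lines
   always meet properly (they are distinct and no three are concurrent), so
   this is not required separately. *)
Definition contact_lines (F : S) (r : nat) (l : 'I_r -> pline) : Prop :=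
  exists p : 'I_r -> ppoint,
    injective p /\ forall i, tangent_line F (p i) (l i).

End ProjectivePlane.

(* Main.v *)
(* Parametrize the lines tangent to the conic as x0 t^2 - x1 t + x2 = 0 in
   suitable coordinates. A point of the plane is then an unordered pair {x, y}
   of parameters, and a form f of degree d becomes a symmetric polynomial f(x, y)
   of degree at most d in each variable. The star configuration of the tangents
   t_1, ..., t_r consists of the pairs {t_i, t_j}, so f vanishes on it iff the
   alternating polynomial (x - y) f(x, y) vanishes on the whole grid of the
   (t_i, t_j). Expand that polynomial in products w_p(x) w_q(y), where w is a
   basis of the polynomials of degree at most e = d + 1 such that w_p is
   divisible by prod (X - t_i) iff p <= e - r, and by prod (X - u_j) iff p >= s.
   Vanishing on both stars says that the coefficient of w_p(x) w_q(y), p < q, is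
   zero unless p <= e - r and q >= s. Sending (p, q) to X^p Y^(e - q) Z^(q - p - 1)
   turns this into the condition satisfied by the monomials of the forms of degree
   d in (Y, Z)^(r - 1) and (X, Z)^(s - 1), the two fat points. *)

Require Import Defs.
From HB Require Import structures.
From mathcomp Require Import all_boot all_order all_algebra.
From mathcomp Require Import mpoly complex boolp classical_sets reals.
From mathcomp Require Import ring zify.

Set Implicit Arguments.
Unset Strict Implicit.
Unset Printing Implicit Defensive.

Import Order.TTheory GRing.Theory Num.Theory.

Local Open Scope classical_set_scope.
Local Open Scope ring_scope.

(** * Preliminaries: dimension counts, zeros of polynomials, vectors of length 3 *)

Lemma big_ord3 (T : Type) (idx : T) (op : Monoid.law idx) (F : 'I_3 -> T) :
  \big[op/idx]_(i < 3) F i = op (op (F 0) (F 1)) (F 2%:R).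
Proof.
rewrite !big_ord_recr big_ord0 /= Monoid.mul1m.
by congr (op (op (F _) (F _)) (F _)); apply: val_inj.
Qed.

(** Injective endomorphisms of a finite-dimensional space are bijective, so [f] maps [U] and [g]
    maps [W] onto the same set, the vectors satisfying [C], and both preserve dimension. *)
Lemma dim_eq_of_injective_maps (K : fieldType) (V : vectType K)
    (f g : {linear V -> V}) (C : V -> Prop) (U W : {vspace V}) :
  injective f -> injective g ->
  (forall x, x \in U <-> C (f x)) -> (forall x, x \in W <-> C (g x)) ->
  \dim U = \dim W.
Proof.
move=> fI gI UC WC.
have kf (h : {linear V -> V}) : injective h -> lker (linfun h) == 0%VS.
  move=> hI; apply/lker0P => x y; rewrite !lfunE; exact: hI.
have surj (h : {linear V -> V}) : injective h -> forall y, exists x, y = h x.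
  move=> hI y; have : y \in limg (linfun h).
    suff -> : limg (linfun h) = fullv by rewrite memvf.
    apply/eqP; rewrite -dimv_leqif_eq ?subvf // limg_dim_eq //.
    by rewrite (eqP (kf h hI)) capv0.
  by case/memv_imgP => x _ ->; exists x; rewrite lfunE.
rewrite -(@limg_dim_eq _ _ _ (linfun f) U); last first.
  by rewrite (eqP (kf f fI)) capv0.
rewrite -(@limg_dim_eq _ _ _ (linfun g) W); last first.
  by rewrite (eqP (kf g gI)) capv0.
congr (\dim _); apply/vspaceP => y; apply/memv_imgP/memv_imgP => -[x xU ->];
  rewrite lfunE /=.
- have [z fz] := surj g gI (f x); exists z; last by rewrite lfunE.
  by apply/WC; rewrite -fz; apply/UC.
- have [z fz] := surj f fI (g x); exists z; last by rewrite lfunE.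
  by apply/UC; rewrite -fz; apply/WC.
Qed.

Lemma poly_eq0_of_horner (K : numDomainType) (p : {poly K}) :
  (forall x, p.[x] = 0) -> p = 0.
Proof.
move=> p0; apply/eqP; case: (eqVneq p 0) => // pn0; exfalso.
have := @max_poly_roots K p [seq n%:R | n <- iota 0 (size p)] pn0.
rewrite size_map size_iota ltnn => H; suff: false by []; apply: H.
  by apply/allP => x _; rewrite /root p0.
rewrite map_inj_in_uniq ?iota_uniq // => x y _ _ /eqP.
by rewrite eqr_nat => /eqP.
Qed.

Lemma horner_bounded_eq0 (K : fieldType) (p : {poly K}) (u : nat -> K) (n : nat) :
  injective u -> (size p <= n)%N -> (forall k, (k < n)%N -> p.[u k] = 0) -> p = 0.
Proof.
move=> uI sp p0; apply/eqP; case: (eqVneq p 0) => // pn0; exfalso.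
have := @max_poly_roots K p [seq u i | i <- iota 0 n] pn0.
rewrite size_map size_iota ltnNge sp => H; suff: false by []; apply: H.
  rewrite all_map; apply/allP => i; rewrite mem_iota add0n => /andP [_ ilt].
  by rewrite /= /root p0.
by rewrite map_inj_uniq ?iota_uniq.
Qed.

Definition vec3 (K : Type) (x y z : K) : 'rV[K]_3 :=
  \row_i (if i == 0 then x else if i == 1 then y else z).

Lemma vec3E (K : Type) (x y z : K) :
  (vec3 x y z 0 0 = x) * (vec3 x y z 0 1 = y) * (vec3 x y z 0 2%:R = z).
Proof. by rewrite !mxE. Qed.

Lemma vec3_eta (K : Type) (v : 'rV[K]_3) : v = vec3 (v 0 0) (v 0 1) (v 0 2%:R).
Proof.
apply/rowP => i; rewrite mxE; case: i => [[|[|[|]]]] // ilt;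
  by rewrite /=; congr (v _ _); apply: val_inj.
Qed.

(** * Linear substitutions in ternary forms *)

Section Substitution.
Variable K : fieldType.
Local Notation S := {mpoly K[3]}.

Lemma meval_homog_scale (f : S) d (c : K) (v : 'rV[K]_3) :
  f \is d.-homog -> f.@[(c *: v) 0] = c ^+ d * f.@[v 0].
Proof.
move=> fh; rewrite !mevalE mulr_sumr big_seq [RHS]big_seq.
apply: eq_bigr => m /(dhomog_mf fh) /= <-.
rewrite mulrCA; congr (_ * _); rewrite mdegE expr_sum -big_split /=.
by apply: eq_bigr => i _; rewrite mxE exprMn.
Qed.

Definition linform (M : 'M[K]_3) (i : 'I_3) : S := \sum_j M j i *: 'X_j.

Lemma linform_homog M i : linform M i \is 1.-homog.
Proof. by apply: rpred_sum => j _; apply: rpredZ; rewrite dhomogX /= mdeg1. Qed.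

Lemma meval_linform M i (v : 'rV[K]_3) : (linform M i).@[v 0] = (v *m M) 0 i.
Proof.
rewrite raddf_sum mxE; apply: eq_bigr => j _.
by rewrite /= mevalZ mevalXU mulrC.
Qed.

Definition lin_subst (M : 'M[K]_3) (f : S) : S := f \mPo [tuple linform M i | i < 3].

Lemma lin_substE M f :
  lin_subst M f = \sum_(m <- msupp f) f@_m *: \prod_(i < 3) linform M i ^+ m i.
Proof.
rewrite /lin_subst comp_mpolyE; apply: eq_bigr => m _; congr (_ *: _).
by apply: eq_bigr => i _; rewrite tnth_mktuple.
Qed.

Lemma meval_lin_subst M f (v : 'rV[K]_3) :
  (lin_subst M f).@[v 0] = f.@[(v *m M) 0].
Proof.
rewrite /lin_subst comp_mpoly_meval; apply: meval_eq => i.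
by rewrite tnth_mktuple meval_linform.
Qed.

Lemma lin_subst_homog M f d : f \is d.-homog -> lin_subst M f \is d.-homog.
Proof.
move=> fh; rewrite lin_substE big_seq; apply: rpred_sum => m /(dhomog_mf fh) /= <-.
apply: rpredZ; rewrite mdegE !big_ord3 /=.
by do ?apply: dhomogM; rewrite -[X in X.-homog]mul1n; apply: dhomogMn (linform_homog _ _).
Qed.

Lemma lin_subst_is_linear M : linear (lin_subst M).
Proof. by move=> c f g; rewrite /lin_subst linearP. Qed.

Lemma lin_substM M f g : lin_subst M (f * g) = lin_subst M f * lin_subst M g.
Proof. by rewrite /lin_subst rmorphM. Qed.

End Substitution.

(** Since y <= d, the numbers [y] and [z] are the remainder and the quotient of y + (d + 3) z by d +
    3; the degree then determines [x]. *)
Lemma kronecker_exponent_inj (d x y z x' y' z' : nat) :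
  (x + y + z)%N = d -> (x' + y' + z')%N = d ->
  (y + (d + 3) * z = y' + (d + 3) * z')%N -> [/\ x = x', y = y' & z = z'].
Proof.
move=> d1 d2 e.
have dv b c : (b < d + 3)%N -> ((b + (d + 3) * c) %/ (d + 3))%N = c.
  move: {e} (d + 3)%N => N bN; rewrite addnC mulnC divnMDl; last by case: N bN.
  by rewrite divn_small ?addn0.
have e2 : z = z' by rewrite -(dv y z) ?e ?dv //; lia.
by subst z'; split; lia.
Qed.

(** * Ternary forms are determined by their values *)

Section InfiniteField.
Variable K : numFieldType.
Local Notation S := {mpoly K[3]}.

(* Kronecker substitution: on monomials of degree d the exponent of T in
   (1, T, T^(d+3)) determines the monomial. *)
Lemma homog_eq0_of_curve (f : S) d (q : {poly K}) :
  f \is d.-homog -> q != 0 ->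
  (forall T, q.[T] != 0 -> f.@[vec3 1 T (T ^+ (d + 3)) 0] = 0) -> f = 0.
Proof.
move=> fh q0 f0; pose e (m : 'X_{1..3}) := (m 1%R + (d + 3) * m 2%:R%R)%N.
pose k := \sum_(m <- msupp f) f@_m *: ('X^(e m) : {poly K}).
have degE (m : 'X_{1..3}) : mdeg m = (m 0%R + m 1%R + m 2%:R%R)%N.
  by rewrite mdegE big_ord3.
have k0 : k = 0.
  (* The zeros of [q] are the finitely many parameters at which nothing is known about [f]. The
     product of [q] and [k] vanishes at every T, hence is zero, while [q] is not. *)
  apply/eqP; move: q0; apply: contraNT => kn0; rewrite -[q == 0]orFb.
  rewrite -(negbTE kn0) -mulf_eq0; apply/eqP/poly_eq0_of_horner => T.
  rewrite hornerM; case: (eqVneq q.[T] 0) => [->|qT]; first by rewrite mulr0.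
  suff -> : k.[T] = f.@[vec3 1 T (T ^+ (d + 3)) 0] by rewrite f0 // mul0r.
  rewrite /k horner_sum mevalE; apply: eq_bigr => m _.
  by rewrite hornerZ hornerXn big_ord3 /= !vec3E expr1n mul1r -exprM exprD.
apply/mpolyP => m; rewrite mcoeff0.
case: (boolP (m \in msupp f)) => [mf|]; last by move/memN_msupp_eq0.
have <- : k`_(e m) = f@_m; last by rewrite k0 coef0.
rewrite /k coef_sum (bigD1_seq m) ?msupp_uniq //= coefZ coefXn eqxx mulr1.
rewrite big_seq_cond big1 ?addr0 // => m' /andP [m'f m'm].
rewrite coefZ coefXn; case: eqP => [|_]; last by rewrite mulr0.
have := dhomog_mf fh mf; have := dhomog_mf fh m'f; rewrite /= !degE /e.
move=> d1 d2 em; exfalso; move/eqP: m'm; apply.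
have [e0 e1 e2] := kronecker_exponent_inj d1 d2 (esym em).
apply/mnmP => -[[|[|[|]]]] // ilt.
- by rewrite (_ : Ordinal ilt = 0) //; apply: val_inj.
- by rewrite (_ : Ordinal ilt = 1) //; apply: val_inj.
- by rewrite (_ : Ordinal ilt = 2%:R) //; apply: val_inj.
Qed.

Lemma homog_eq_of_meval (f g : S) d :
  f \is d.-homog -> g \is d.-homog ->
  (forall v : 'rV[K]_3, f.@[v 0] = g.@[v 0]) -> f = g.
Proof.
move=> fh gh fg; apply/eqP; rewrite -subr_eq0; apply/eqP.
apply: (@homog_eq0_of_curve _ d 1); rewrite ?oner_neq0 //; first exact: rpredB.
by move=> T _; rewrite mevalB fg subrr.
Qed.

Lemma lin_substK (M : 'M[K]_3) (f : S) d : M \in unitmx -> f \is d.-homog ->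
  lin_subst (invmx M) (lin_subst M f) = f.
Proof.
move=> Mu fh; apply: (@homog_eq_of_meval _ _ d) => //.
  exact/lin_subst_homog/lin_subst_homog.
by move=> v; rewrite !meval_lin_subst mulmxKV.
Qed.

End InfiniteField.

(** * Powers and generators of ideals *)

Section IdealPowers.
Variable A : comNzRingType.

Lemma ideal_pow_sub (I J : set A) n : is_ideal J ->
  (forall g : 'I_n -> A, (forall i, I (g i)) -> J (\prod_(i < n) g i)) ->
  ideal_pow I n `<=` J.
Proof.
case=> J0 JD JM JI _ [k [h [g [gI ->]]]].
elim/big_ind: _ => // i _; apply: JM.
by have [gi [giI ->]] := gI i; apply: JI.
Qed.

Lemma ideal_gen_sub (G J : set A) : is_ideal J -> G `<=` J -> ideal_gen G `<=` J.
Proof.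
case=> J0 JD JM GJ _ [k [h [g [gG ->]]]].
by elim/big_ind: _ => // i _; apply/JM/GJ.
Qed.

Lemma sub_ideal_gen (G : set A) : G `<=` ideal_gen G.
Proof.
move=> f Gf; exists 1%N, (fun=> 1), (fun=> f); split=> //.
by rewrite big_ord1 mul1r.
Qed.

(** The first [n] factors form a generator of the power; the remaining ones are absorbed into the
    coefficient. *)
Lemma ideal_pow_prod_seq (I : set A) n (h : A) (s : seq A) :
  (forall x, x \in s -> I x) -> (n <= size s)%N ->
  ideal_pow I n (h * \prod_(x <- s) x).
Proof.
move=> sI ns; exists 1%N, (fun=> h * \prod_(x <- drop n s) x),
  (fun=> \prod_(x <- take n s) x); split.
  move=> _; exists (fun i : 'I_n => s`_i); split=> [i|].
    by apply: sI; rewrite mem_nth // (leq_trans (ltn_ord i)).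
  rewrite (big_nth 0) size_takel // big_mkord.
  by apply: eq_bigr => i _; rewrite nth_take.
by rewrite big_ord1 -mulrA; congr (h * _); rewrite mulrC -big_cat cat_take_drop.
Qed.

End IdealPowers.

(** * Fat points as conditions on monomials *)

Section FatPoints.
Variable K : numFieldType.
Local Notation S := {mpoly K[3]}.

Lemma vanishes_at_line (f : S) d (P : ppoint K) (v : 'rV[K]_3) :
  f \is d.-homog -> val P = <[v]>%VS -> vanishes_at f P <-> f.@[v 0] = 0.
Proof.
move=> fh Pv; split=> [H|fv w]; first by apply: H; rewrite Pv memv_line.
by rewrite Pv => /vlineP [c ->]; rewrite (meval_homog_scale _ _ fh) fv mulr0.
Qed.

(** Combinations of forms vanishing on [X] still vanish on [X], so a form in the ideal is itself one
    of the generators. *)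
Lemma point_ideal_homogP (X : set (ppoint K)) (f : S) d : f \is d.-homog ->
  point_ideal X f <-> forall P, X P -> vanishes_at f P.
Proof.
move=> fh; split=> [|H]; last by apply: sub_ideal_gen; exists d.
case=> n [h [g [gX ->]]] P XP v vP; rewrite raddf_sum big1 //= => i _.
by have [e [_ /(_ P XP v vP) gv]] := gX i; rewrite mevalM gv mulr0.
Qed.

(* Membership in the n-th power of the ideal of the i-th coordinate point. *)
Definition order_ge (i : 'I_3) (n : nat) (f : S) : Prop :=
  forall m, m \in msupp f -> (m i + n <= mdeg m)%N.

(** Monomials of a product are sums of monomials of the factors, so multiplication by [h] cannot
    lower the degree in the variables other than the [i]-th. *)
Lemma order_ge_ideal i n (M : 'M[K]_3) :
  is_ideal [set f | order_ge i n (lin_subst M f)].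
Proof.
split=> /=.
- by move=> m; rewrite /lin_subst raddf0 msupp0.
- move=> f g fn gn m; rewrite /lin_subst raddfD => /msuppD_le.
  by rewrite mem_cat => /orP [/fn|/gn].
- move=> h f fn m; rewrite lin_substM => /msuppM_le.
  case/allpairsP => -[m1 m2] /= [_ /fn le2 ->].
  rewrite mnmDE mdegD -addnA leq_add //.
  by rewrite mdegE (bigD1 i) //= leq_addr.
Qed.

Lemma order_geM i n1 n2 f g :
  order_ge i n1 f -> order_ge i n2 g -> order_ge i (n1 + n2) (f * g).
Proof.
move=> fn gn m /msuppM_le /allpairsP [[m1 m2] /= [/fn le1 /gn le2 ->]].
by rewrite mnmDE mdegD addnACA leq_add.
Qed.

Lemma order_ge_prod i n (g : 'I_n -> S) :
  (forall k, order_ge i 1 (g k)) -> order_ge i n (\prod_(k < n) g k).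
Proof.
elim: n g => [|n IHn] g gn.
  move=> m; rewrite big_ord0 msupp1 inE => /eqP ->.
  by rewrite mnm0E.
rewrite big_ord_recl -[X in order_ge _ X _]add1n; apply: order_geM => //.
by apply: IHn => k; apply: gn.
Qed.

(** The value at the [i]-th coordinate point is the coefficient of X_i^d: every other monomial of
    degree [d] contains a variable that is zero there. *)
Lemma mdeg_gt_of_vanishing i (f : S) d :
  f \is d.-homog -> f.@[(delta_mx 0 i : 'rV[K]_3) 0] = 0 -> order_ge i 1 f.
Proof.
move=> fh f0 m mf; rewrite addn1 ltn_neqAle; apply/andP; split; last first.
  by rewrite mdegE (bigD1 i) //= leq_addr.
apply/eqP => mi; move: (mf); rewrite mcoeff_msupp => /eqP; apply; rewrite -{}f0.
have dE (m' : 'X_{1..3}) : mdeg m' = (m' i + \sum_(j | j != i) m' j)%N.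
  by rewrite mdegE (bigD1 i).
have pureE (m' : 'X_{1..3}) : (forall j, j != i -> m' j = 0%N) -> m' = (U_(i) *+ mdeg m')%MM.
  move=> H; apply/mnmP => j; rewrite mulmnE mnm1E; case: eqVneq => [<-|ij].
    by rewrite dE big1 ?addn0 ?mul1n.
  by rewrite H // eq_sym.
have m0 j : j != i -> m j = 0%N.
  move=> ji; apply/eqP; have := dE m; rewrite -mi -{1}[m i]addn0.
  by move/addnI/esym/eqP; rewrite sum_nat_eq0 => /forallP /(_ j) /implyP; apply.
rewrite mevalE (bigD1_seq m) ?msupp_uniq //= (bigD1 i) //= mxE !eqxx expr1n mul1r.
rewrite (big1 _ (fun j => j != i)) ?mulr1 => [|j /m0 ->] //.
rewrite big_seq_cond big1 ?addr0 // => m' /andP [m'f m'm].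
have [j ji mj] : exists2 j, j != i & m' j != 0%N.
  apply/exists_inP; move: m'm; apply: contraR; rewrite negb_exists_in => /forall_inP H.
  rewrite [m]pureE // [m']pureE; last by move=> j ji; apply/eqP; rewrite -[_ == _]negbK H.
  by rewrite (dhomog_mf fh mf) (dhomog_mf fh m'f).
by rewrite (bigD1 j) //= mxE (negbTE ji) andbF expr0n (negbTE mj) mul0r mulr0.
Qed.

(** Each factor from the point ideal adds at least one to the order. Conversely, [f] is a
    combination of monomials in the linear forms dual to the rows of [E], and all of these forms
    except the [i]-th vanish at [P]. *)
Lemma fat_ideal_homogP (E : 'M[K]_3) i n (P : ppoint K) (f : S) d :
  E \in unitmx -> val P = <[row i E]>%VS -> f \is d.-homog ->
  ideal_pow (point_ideal [set P]) n f <-> order_ge i n (lin_subst E f).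
Proof.
move=> Eu PE fh; have Ei k := order_ge_ideal i k E; split=> [|fn].
  move: f {fh}; apply: (ideal_pow_sub (Ei n)) => g gP /=.
  rewrite /lin_subst rmorph_prod; apply: order_ge_prod => k.
  move: (g k) (gP k); apply: (ideal_gen_sub (Ei 1%N)) => {gP k} g [e [gh gP]].
  apply: (mdeg_gt_of_vanishing (lin_subst_homog E gh)).
  by rewrite meval_lin_subst -rowE; apply: (gP P) => //; rewrite PE memv_line.
rewrite -(lin_substK Eu fh) lin_substE.
have [J0 JD JM] : is_ideal (ideal_pow (point_ideal [set P]) n) := is_ideal_gen _.
rewrite big_seq; elim/big_ind: _ => // m mf.
rewrite -mul_mpolyC; apply: JM; rewrite (bigD1 i) //=.
set L := linform (invmx E); have LP j : j != i -> point_ideal [set P] (L j).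
  move=> ji; apply/(point_ideal_homogP _ (linform_homog _ _)) => _ ->.
  apply/(vanishes_at_line (linform_homog _ _) PE); rewrite meval_linform.
  by rewrite -row_mul mulmxV // !mxE eq_sym (negbTE ji).
(* The factors vanishing at [P], with multiplicity; their number is mdeg m - m i, which is at least
   [n]. *)
pose s := flatten [seq nseq (m j) (L j) | j <- enum (predC1 i)].
have -> : \prod_(j | j != i) L j ^+ m j = \prod_(x <- s) x.
  rewrite big_flatten big_map big_enum /=; apply: eq_bigr => j _.
  by rewrite big_nseq iter_mulr_1.
apply: ideal_pow_prod_seq => [x /flatten_mapP [j]|].
  by rewrite mem_enum => /LP Lj; rewrite mem_nseq => /andP [_ /eqP ->].
rewrite size_flatten /shape -map_comp sumnE big_map big_enum /=.
under eq_bigr do rewrite size_nseq.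
by have := fn m mf; rewrite mdegE (bigD1 i) //= leq_add2l.
Qed.

End FatPoints.

(** * Newton bases and vanishing on grids *)

Section NewtonBasis.
Variable K : fieldType.
Implicit Types (t u : nat -> K) (e : nat).

(* Divisible by prod_(j < s) (X - u j) iff s <= p, and by
   prod_(i < r) (X - t i) iff p + r <= e: the basis is adapted to both flags. *)
Definition newton u t e (p : nat) : {poly K} :=
  \prod_(j < p) ('X - (u j)%:P) * \prod_(i < e - p) ('X - (t i)%:P).

(** Exchanging the two sequences reverses the basis; this transfers statements about the grid of [u]
    to the grid of [t]. *)
Lemma newton_rev u t e p : (p <= e)%N -> newton u t e (e - p) = newton t u e p.
Proof. by move=> pe; rewrite /newton subKn // mulrC. Qed.

Lemma size_newton u t e p : (p <= e)%N -> (size (newton u t e p) <= e.+1)%N.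
Proof.
move=> pe; rewrite size_mul ?size_prod_XsubC /index_enum -?enumT ?size_enum_ord.
- by rewrite addSn addnS /= subnKC.
- by apply/monic_neq0/monic_prod_XsubC.
- by apply/monic_neq0/monic_prod_XsubC.
Qed.

Lemma newton_horner_eq0 u t e p k : (k < p)%N -> (newton u t e p).[u k] = 0.
Proof.
by move=> kp; rewrite hornerM horner_prod (bigD1 (Ordinal kp)) //= !hornerE subrr !mul0r.
Qed.

Variables (u t : nat -> K) (e : nat).
Hypotheses (uI : injective u) (tI : injective t) (ut : forall i j, u i <> t j).

Lemma newton_horner_neq0 p : (newton u t e p).[u p] != 0.
Proof.
rewrite hornerM !horner_prod mulf_neq0 //; apply/prodf_neq0 => i _; rewrite !hornerE subr_eq0.
  by apply: contraNneq (negbT (ltnn p)) => /uI pi; rewrite {1}pi ltn_ord.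
by apply/eqP/ut.
Qed.

(** The values at the points [u k] form a triangular system with nonzero diagonal, so the
    coefficients vanish one after the other. *)
Lemma newton_coef_eq0 (c : nat -> K) r :
  (forall k, (k < r)%N -> (k <= e)%N ->
     \sum_(p < e.+1) c p * (newton u t e p).[u k] = 0) ->
  forall p, (p < r)%N -> (p <= e)%N -> c p = 0.
Proof.
move=> H; elim/ltn_ind => p IHp pr pe.
have := H p pr pe; rewrite (bigD1 (inord p)) //= inordK // big1 ?addr0 => [|q qp].
  by move/eqP; rewrite mulf_eq0 (negbTE (newton_horner_neq0 p)) orbF => /eqP.
case: (ltngtP q p) => [qlt|qlt|qeq].
- by rewrite (IHp _ qlt (ltn_trans qlt pr) (leq_trans (ltnW qlt) pe)) mul0r.
- by rewrite newton_horner_eq0 ?mulr0.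
- by move: qp; rewrite -val_eqE /= inordK // qeq eqxx.
Qed.

Lemma newton_sum_eq0 (c : nat -> K) r k :
  (forall p, (p < r)%N -> (p <= e)%N -> c p = 0) -> (k < r)%N ->
  \sum_(p < e.+1) c p * (newton u t e p).[u k] = 0.
Proof.
move=> H kr; apply: big1 => p _; case: (ltnP p r) => [pr|rp].
  by rewrite H ?mul0r // -ltnS.
by rewrite newton_horner_eq0 ?mulr0 // (leq_trans kr).
Qed.

(** The triangular argument is applied to one variable at a time: the inner sums are the
    coefficients of the outer one. *)
Lemma newton_grid_eq0 (c : nat -> nat -> K) (r : nat) :
  (forall k l, (k < r)%N -> (l < r)%N -> \sum_(p < e.+1) \sum_(q < e.+1)
     c p q * (newton u t e p).[u k] * (newton u t e q).[u l] = 0) <->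
  (forall p q, (p < r)%N -> (q < r)%N -> (p <= e)%N -> (q <= e)%N -> c p q = 0).
Proof.
have sumE k l : \sum_(p < e.+1) \sum_(q < e.+1)
     c p q * (newton u t e p).[u k] * (newton u t e q).[u l] =
   \sum_(p < e.+1) (\sum_(q < e.+1) c p q * (newton u t e q).[u l])
     * (newton u t e p).[u k].
  by apply: eq_bigr => p _; rewrite mulr_suml; apply: eq_bigr => q _; rewrite mulrAC.
split=> [H p q pr qr pe qe|H k l kr lr].
  apply: (@newton_coef_eq0 (c p) r) qr qe => l lr _.
  apply: (@newton_coef_eq0 (fun p => \sum_(q < e.+1) c p q * (newton u t e q).[u l]) r)
    pr pe => k kr _.
  by rewrite -sumE H.
rewrite sumE; apply: (@newton_sum_eq0 (fun p =>
  \sum_(q < e.+1) c p q * (newton u t e q).[u l]) r) => // p pr pe.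
by apply: (@newton_sum_eq0 (c p) r) => // q qr qe; apply: H.
Qed.

Definition newton_mx : 'M[K]_e.+1 := \matrix_(k, p) (newton u t e p).[u k].

Lemma newton_mx_unit : newton_mx \in unitmx.
Proof.
rewrite unitmxE det_trig; last first.
  by apply/is_trig_mxP => i j ij; rewrite mxE newton_horner_eq0.
rewrite unitfE; apply/prodf_neq0 => i _; rewrite mxE; exact: newton_horner_neq0.
Qed.

(* Coordinates of a bivariate polynomial function of degree at most e in each
   variable, read off from its values on the grid (u k, u l). *)
Definition newton_coord (g : K -> K -> K) : 'M[K]_e.+1 :=
  invmx newton_mx *m (\matrix_(k, l) g (u k) (u l)) *m (invmx newton_mx)^T.

Lemma newton_coord_grid g k l : (k <= e)%N -> (l <= e)%N ->
  g (u k) (u l) = \sum_(p < e.+1) \sum_(q < e.+1)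
    newton_coord g p q * (newton u t e p).[u k] * (newton u t e q).[u l].
Proof.
move=> ke le.
have : newton_mx *m newton_coord g *m newton_mx^T = \matrix_(k, l) g (u k) (u l).
  rewrite /newton_coord !mulmxA mulmxV ?newton_mx_unit // mul1mx -mulmxA -trmx_mul.
  by rewrite mulmxV ?newton_mx_unit // trmx1 mulmx1.
move/matrixP => /(_ (inord k) (inord l)); rewrite [RHS]mxE !inordK // => <-.
rewrite mxE exchange_big /=; apply: eq_bigr => q _.
rewrite !mxE inordK // mulr_suml; apply: eq_bigr => p _.
by rewrite !mxE inordK //; congr (_ * _); rewrite mulrC.
Qed.

(** Both sides have degree at most [e] in each variable and agree on a grid of e + 1 by e + 1
    points. *)
Lemma newton_coordE g :
  (forall y, exists2 h : {poly K}, (size h <= e.+1)%N & forall x, g x y = h.[x]) ->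
  (forall x, exists2 h : {poly K}, (size h <= e.+1)%N & forall y, g x y = h.[y]) ->
  forall x y, g x y = \sum_(p < e.+1) \sum_(q < e.+1)
    newton_coord g p q * (newton u t e p).[x] * (newton u t e q).[y].
Proof.
move=> g1 g2.
have ext (a b : K -> K) (ha : exists2 h : {poly K}, (size h <= e.+1)%N & forall x, a x = h.[x])
    (hb : exists2 h : {poly K}, (size h <= e.+1)%N & forall x, b x = h.[x]) :
    (forall k, (k <= e)%N -> a (u k) = b (u k)) -> forall x, a x = b x.
  case: ha hb => h1 s1 E1 [h2 s2 E2] ab x; rewrite E1 E2.
  suff /eqP : h1 - h2 = 0 by rewrite subr_eq0 => /eqP ->.
  apply: (horner_bounded_eq0 (n := e.+1) uI) => [|k kn].
    by rewrite (leq_trans (size_polyD _ _)) // size_polyN geq_max s1.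
  by rewrite hornerD hornerN -E1 -E2 ab ?subrr.
have lc (c : nat -> K) : exists2 h : {poly K}, (size h <= e.+1)%N &
    forall x, \sum_(p < e.+1) c p * (newton u t e p).[x] = h.[x].
  exists (\sum_(p < e.+1) c p *: newton u t e p).
    apply: (leq_trans (size_sum _ _ _)); apply/bigmax_leqP => p _.
    by rewrite (leq_trans (size_scale_leq _ _)) ?size_newton // -ltnS.
  by move=> x; rewrite horner_sum; apply: eq_bigr => p _; rewrite hornerZ.
have lcx (c : 'M[K]_e.+1) y : exists2 h : {poly K}, (size h <= e.+1)%N & forall x,
    \sum_(p < e.+1) \sum_(q < e.+1)
      c p q * (newton u t e p).[x] * (newton u t e q).[y] = h.[x].
  have [h sh hE] := lc (fun p => \sum_(q < e.+1) c (inord p) q * (newton u t e q).[y]).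
  exists h => // x; rewrite -hE; apply: eq_bigr => p _; rewrite mulr_suml.
  by apply: eq_bigr => q _; rewrite inord_val mulrAC.
have lcy (c : 'M[K]_e.+1) x : exists2 h : {poly K}, (size h <= e.+1)%N & forall y,
    \sum_(p < e.+1) \sum_(q < e.+1)
      c p q * (newton u t e p).[x] * (newton u t e q).[y] = h.[y].
  have [h sh hE] := lcx c^T x; exists h => // y; rewrite -hE exchange_big.
  by apply: eq_bigr => p _; apply: eq_bigr => q _; rewrite mxE mulrAC.
(* Equality is extended from the grid first in x, for y on the grid, and then in y, for arbitrary
   x. *)
move=> x y; move: y x; have H l : (l <= e)%N -> forall x, g x (u l) = \sum_(p < e.+1)
    \sum_(q < e.+1) newton_coord g p q * (newton u t e p).[x] * (newton u t e q).[u l].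
  by move=> le; apply: ext => // k ke; apply: newton_coord_grid.
by move=> y x; move: y; apply: ext => // k ke; apply: H.
Qed.

End NewtonBasis.

(** * Rational parametrization of the tangents to a conic *)

Section ConicParametrization.
Variable K : numFieldType.

(** All terms of the sequence exceed the absolute value of every [s k]. *)
Lemma exists_fresh (I : finType) (s : I -> K) :
  exists z : nat -> K, injective z /\ forall k n, s k != z n.
Proof.
exists (fun n => 1 + \sum_k `|s k| + n%:R); split=> [m n /addrI/eqP|k n].
  by rewrite eqr_nat => /eqP.
apply/eqP => sk; have s0 : 0 <= \sum_k `|s k| by apply: sumr_ge0 => j _.
have : `|s k| <= \sum_k `|s k|.
  by rewrite (bigD1 k) //= lerDl; apply: sumr_ge0 => j _.
rewrite sk ger0_norm ?addr_ge0 // addrAC gerDr.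
by rewrite lt_geF // ltr_wpDr.
Qed.

Lemma det2 (A : 'M[K]_2) : \det A = A 0 0 * A 1 1 - A 0 1 * A 1 0.
Proof.
rewrite (expand_det_row _ 0) !big_ord_recl big_ord0 /cofactor !det_mx11 !mxE /=.
have -> : lift (0 : 'I_2) 0 = 1 by apply: val_inj.
have -> : lift (1 : 'I_2) 0 = 0 by apply: val_inj.
by ring.
Qed.

Lemma det3 (A : 'M[K]_3) : \det A =
  A 0 0 * (A 1 1 * A 2%:R 2%:R - A 1 2%:R * A 2%:R 1)
  - A 0 1 * (A 1 0 * A 2%:R 2%:R - A 1 2%:R * A 2%:R 0)
  + A 0 2%:R * (A 1 0 * A 2%:R 1 - A 1 1 * A 2%:R 0).
Proof.
rewrite (expand_det_row _ 0) big_ord3 /cofactor !det2 !mxE.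
have -> : lift (0 : 'I_3) 0 = 1 by apply: val_inj.
have -> : lift (0 : 'I_3) 1 = 2%:R by apply: val_inj.
have -> : lift (1 : 'I_3) 0 = 0 by apply: val_inj.
have -> : lift (1 : 'I_3) 1 = 2%:R by apply: val_inj.
have -> : lift (2%:R : 'I_3) 0 = 0 by apply: val_inj.
have -> : lift (2%:R : 'I_3) 1 = 1 by apply: val_inj.
by rewrite /=; ring.
Qed.

Definition bilin (S : 'M[K]_3) (u v : 'rV[K]_3) : K := (u *m S *m v^T) 0 0.

Lemma bilin_mulmx (S Q : 'M[K]_3) x y :
  bilin S (x *m Q) (y *m Q) = bilin (Q *m S *m Q^T) x y.
Proof. by rewrite /bilin trmx_mul !mulmxA. Qed.

Lemma bilin_row (S Q : 'M[K]_3) i j :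
  (Q *m S *m Q^T) i j = bilin S (row i Q) (row j Q).
Proof. by rewrite /bilin -row_mul !mxE; apply: eq_bigr => k _; rewrite !mxE. Qed.

Lemma bilinZl S c u v : bilin S (c *: u) v = c * bilin S u v.
Proof. by rewrite /bilin -!scalemxAl mxE. Qed.

Lemma bilinC S u v : S^T = S -> bilin S u v = bilin S v u.
Proof.
move=> sS; rewrite /bilin (_ : v *m S *m u^T = (u *m S *m v^T)^T) ?mxE //.
by rewrite !trmx_mul trmxK sS mulmxA.
Qed.

Lemma bilinZr S c u v : bilin S u (c *: v) = c * bilin S u v.
Proof. by rewrite /bilin linearZ /= -scalemxAr mxE. Qed.

Lemma bilinE S u v : bilin S u v = \sum_j (u *m S) 0 j * v 0 j.
Proof. by rewrite /bilin mxE; apply: eq_bigr => j _; rewrite [v^T _ _]mxE. Qed.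

Lemma bilin_hollow (g : K) x y :
  bilin (g *: (const_mx 1 - 1%:M)) x y =
  g * (x 0 0 * (y 0 1 + y 0 2%:R) + x 0 1 * (y 0 0 + y 0 2%:R)
       + x 0 2%:R * (y 0 0 + y 0 1)).
Proof. by rewrite bilinE big_ord3 !mxE !big_ord3 !mxE /=; ring. Qed.

(* Three of the points are used as basis of the plane, scaled so that the Gram
   matrix is g (J - 1); projecting the conic from the first of them gives
   parameters s k, and a change of parameter moves that point (s = infinity)
   to 0. *)
Lemma tangent_parametrization (I : finType) (k0 k1 k2 : I) (S : 'M[K]_3)
    (q : I -> 'rV[K]_3) :
  k0 != k1 -> k0 != k2 -> k1 != k2 -> S^T = S ->
  (forall k, bilin S (q k) (q k) = 0) ->
  (forall k l, k != l -> bilin S (q k) (q l) != 0) ->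
  exists M : 'M[K]_3, exists tau : I -> K, [/\ M \in unitmx, injective tau &
    forall k v, bilin S (q k) v = 0 <->
      (v *m M) 0 0 * tau k ^+ 2 - (v *m M) 0 1 * tau k + (v *m M) 0 2%:R = 0].
Proof.
move=> k01 k02 k12 sS qq qn.
(* Each basis vector is scaled by the pairing of the other two, which makes every off-diagonal Gram
   entry equal to a b c. *)
pose a := bilin S (q k1) (q k2); pose b := bilin S (q k0) (q k2).
pose c := bilin S (q k0) (q k1); pose g := a * b * c.
have a0 : a != 0 by exact: qn.
have b0 : b != 0 by exact: qn.
have c0 : c != 0 by exact: qn.
have g0 : g != 0 by rewrite !mulf_neq0.
pose Q : 'M[K]_3 := \matrix_(i < 3)
  (if i == 0 then a *: q k0 else if i == 1 then b *: q k1 else c *: q k2).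
have QS : Q *m S *m Q^T = g *: (const_mx 1 - 1%:M).
  apply/matrixP => i j; rewrite bilin_row !rowK !mxE.
  case: i => [[|[|[|]]]] // ilt; case: j => [[|[|[|]]]] // jlt;
    rewrite /= !bilinZl !bilinZr ?qq; rewrite -/a -/b -/c
    ?(bilinC (q k1) (q k0)) ?(bilinC (q k2) (q k0)) ?(bilinC (q k2) (q k1)) //;
    rewrite -/a -/b -/c /g /=; ring.
have Qu : Q \in unitmx.
  rewrite unitmxE unitfE; apply: contraTneq (g0) => dQ.
  have := congr1 determinant QS; rewrite !det_mulmx dQ !mul0r det3 !mxE /= => /eqP.
  rewrite (_ : _ - _ + _ = 2 * g ^+ 3); last by ring.
  by rewrite eq_sym mulf_eq0 pnatr_eq0 expf_eq0 /= => ->.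
pose x k := q k *m invmx Q; pose A k := x k 0 1 + x k 0 2%:R.
have bE k v : bilin S (q k) v =
    g * (x k 0 0 * ((v *m invmx Q) 0 1 + (v *m invmx Q) 0 2%:R)
       + x k 0 1 * ((v *m invmx Q) 0 0 + (v *m invmx Q) 0 2%:R)
       + x k 0 2%:R * ((v *m invmx Q) 0 0 + (v *m invmx Q) 0 1)).
  by rewrite -bilin_hollow -QS -bilin_mulmx /x !mulmxKV.
have iso k : x k 0 0 * x k 0 1 + x k 0 0 * x k 0 2%:R + x k 0 1 * x k 0 2%:R = 0.
  have /eqP := bE k (q k); rewrite qq eq_sym mulf_eq0 (negbTE g0) -/(x k) /= => /eqP H.
  have : (2 : K) * (x k 0 0 * x k 0 1 + x k 0 0 * x k 0 2%:R + x k 0 1 * x k 0 2%:R) = 0.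
    by rewrite -[RHS]H; ring.
  by move/eqP; rewrite mulf_eq0 pnatr_eq0 /= => /eqP.
have xk0 : x k0 = a^-1 *: delta_mx 0 0.
  rewrite /x (_ : q k0 = a^-1 *: row 0 Q); last by rewrite rowK /= scalerA mulVf ?scale1r.
  by rewrite -scalemxAl -row_mul mulmxV // rowE mulmx1.
have [X0 X1 X2] : [/\ x k0 0 0 = a^-1, x k0 0 1 = 0 & x k0 0 2%:R = 0].
  by rewrite xk0 !mxE /= mulr1 mulr0.
(* Up to the factor g / a, [A k] is the pairing of [q k] with [q k0]. *)
have A0 k : k != k0 -> A k != 0.
  rewrite eq_sym => /(qn _ _); rewrite bE -/(x k) X0 X1 X2 !mul0r !addr0.
  by rewrite !mulf_eq0 !negb_or => /and3P [].
pose s k := x k 0 2%:R / A k; have [z [_ /(_ _ 0%N) sd]] := exists_fresh s; pose d := z 0%N.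
have bs k v : k != k0 -> bilin S (q k) v = g * A k * ((v *m invmx Q) 0 0
     + (v *m invmx Q) 0 1 * s k ^+ 2 + (v *m invmx Q) 0 2%:R * (1 - s k) ^+ 2).
  move=> /A0 Ak; rewrite bE.
  (* Isotropy gives (x0 + x2) (x1 + x2) = x2^2 and (x0 + x1) (x1 + x2) = x1^2. *)
  have e1 : x k 0 0 + x k 0 2%:R = A k * s k ^+ 2.
    apply: (mulIf Ak); rewrite /s; transitivity (x k 0 2%:R ^+ 2); last by field.
    by rewrite /A -[RHS]addr0 -(iso k); ring.
  have e2 : x k 0 0 + x k 0 1 = A k * (1 - s k) ^+ 2.
    apply: (mulIf Ak); have -> : 1 - s k = x k 0 1 / A k.
      by rewrite -[1](mulfV Ak) /s /A -mulrBl addrK.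
    transitivity (x k 0 1 ^+ 2); last by field.
    by rewrite /A -[RHS]addr0 -(iso k); ring.
  transitivity (g * ((v *m invmx Q) 0 0 * A k +
    (v *m invmx Q) 0 1 * (x k 0 0 + x k 0 2%:R) +
    (v *m invmx Q) 0 2%:R * (x k 0 0 + x k 0 1))); first by rewrite /A; ring.
  by rewrite e1 e2; ring.
(* Substituting s = d + 1 / tau in y0 + y1 s^2 + y2 (1 - s)^2 and multiplying by tau^2 gives a
   quadratic in tau. [N] reads off its coefficients, the middle one with opposite sign. *)
pose N : 'M[K]_3 := \matrix_(i < 3) (if i == 0 then vec3 1 0 0 else if i == 1
  then vec3 (d ^+ 2) (- (2 * d)) 1 else vec3 ((1 - d) ^+ 2) (2 * (1 - d)) 1).
have NE (y : 'rV[K]_3) : [/\ (y *m N) 0 0 = y 0 0 + y 0 1 * d ^+ 2 + y 0 2%:R * (1 - d) ^+ 2,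
    (y *m N) 0 1 = - (2 * d) * y 0 1 + 2 * (1 - d) * y 0 2%:R
    & (y *m N) 0 2%:R = y 0 1 + y 0 2%:R].
  by split; rewrite mxE big_ord3 !mxE /=; ring.
have Nu : N \in unitmx.
  rewrite unitmxE unitfE det3 !mxE /= (_ : _ + _ = - 2); last by ring.
  by rewrite oppr_eq0 pnatr_eq0.
pose tau k := if k == k0 then 0 else (s k - d)^-1.
exists (invmx Q *m N), tau; split.
- by rewrite unitmx_mul unitmx_inv Qu.
- have tau0 k : k != k0 -> tau k != 0.
    by move=> kk0; rewrite /tau (negbTE kk0) invr_eq0 subr_eq0.
  move=> k l kl; case: (eqVneq k k0) (tau0 k) kl => [->|kk0] tk kl.
    by case: (eqVneq l k0) => [->//|/tau0]; rewrite -kl /tau eqxx eqxx.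
  have lk0 : l != k0.
    by apply/eqP => lk; move: (tk isT); rewrite kl lk /tau eqxx eqxx.
  have skl : s k = s l.
    by move: kl; rewrite /tau (negbTE kk0) (negbTE lk0) => /invr_inj /addIr.
  (* Equal parameters give the same tangent, so [q l], which lies on its own tangent, would be
     orthogonal to [q k]. *)
  case: (eqVneq k l) => // /qn; rewrite (bs _ _ kk0) skl.
  have /eqP := qq l; rewrite (bs _ _ lk0) mulf_eq0 mulf_eq0 (negbTE g0) (negbTE (A0 l lk0)) /=.
  by move=> /eqP ->; rewrite mulr0 eqxx.
move=> k v; rewrite mulmxA; have [-> -> ->] := NE (v *m invmx Q).
rewrite /tau; case: eqVneq => [->|kk0].
  rewrite bE X0 X1 X2 expr0n !mulr0 !mul0r !addr0 subr0 add0r.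
  split => [/eqP|->]; last by rewrite !mulr0.
  by rewrite !mulf_eq0 invr_eq0 (negbTE a0) (negbTE b0) (negbTE c0) /= => /eqP.
have sd0 : s k - d != 0 by rewrite subr_eq0.
rewrite (bs _ _ kk0); set y := v *m invmx Q; set w := (X in g * A k * X).
rewrite (_ : _ - _ + _ = w / (s k - d) ^+ 2); last by rewrite /w; field.
split => [/eqP|/eqP].
  by rewrite mulf_eq0 mulf_eq0 (negbTE g0) (negbTE (A0 k kk0)) /= => /eqP ->; rewrite mul0r.
by rewrite mulf_eq0 invr_eq0 expf_eq0 (negbTE sd0) orbF => /eqP ->; rewrite mulr0.
Qed.

End ConicParametrization.

(** * Contact lines and their intersection points in parameters *)

Section ContactStars.
Variable K : numFieldType.
Local Notation S := {mpoly K[3]}.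

Lemma linear_form_meval (f : S) (u : 'rV[K]_3) : f \is 1.-homog ->
  f.@[u 0] = \sum_j f@_U_(j) * u 0 j.
Proof.
move=> fh; have {1}-> : f = \sum_j f@_U_(j) *: 'X_j.
  apply/mpolyP => m; rewrite raddf_sum /=.
  case: (eqVneq (mdeg m) 1%N) => [/eqP/mdeg1P [k /eqP ->]|m1].
    rewrite (bigD1 k) //= mcoeffZ mcoeffX eqxx mulr1 big1 ?addr0 // => j jk.
    rewrite mcoeffZ mcoeffX; case: eqP => [/mnmP /(_ j)|_]; last exact: mulr0.
    by rewrite !mnm1E eqxx eq_sym (negbTE jk).
  rewrite (dhomog_nemf_coeff fh m1) big1 // => j _; rewrite mcoeffZ mcoeffX.
  by case: eqP => [mE|_]; [case/eqP: m1; rewrite -mE mdeg1|rewrite mulr0].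
by rewrite raddf_sum; apply: eq_bigr => j _; rewrite /= mevalZ mevalXU.
Qed.

Lemma euler_homog (f : S) d : f \is d.-homog ->
  \sum_i 'X_i * f^`M(i) = f *+ d.
Proof.
move=> fh; rewrite [in RHS](mpolyE f) -sumrMnl.
under eq_bigr => i _ do rewrite [f in f^`M(i)](mpolyE f) raddf_sum mulr_sumr.
rewrite exchange_big /= big_seq [RHS]big_seq; apply: eq_bigr => m mf.
rewrite -(dhomog_mf fh mf) /= mdegE -sumrMnr; apply: eq_bigr => i _.
rewrite mderivZ mderivX -!scalerAr.
case: (posnP (m i)) => [->|mi]; first by rewrite scale0r scaler0 mulr0n.
rewrite -mpolyXD addmC submK; first by rewrite scaler_nat scalerMnr.
by apply/mnm_lepP => j; rewrite mnm1E; case: eqP => [<-|].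
Qed.

(** [B] is the Hessian matrix of [F], and Euler's relation gives its quadratic form. The tangent at
    a point is thereby the polar line of that point. *)
Lemma polar_form (F : S) : F \is 2.-homog -> exists B : 'M[K]_3, [/\ B^T = B,
  forall u v, bilin B u v = \sum_(i < 3) (F^`M(i)).@[u 0] * v 0 i &
  forall u, bilin B u u = F.@[u 0] *+ 2].
Proof.
move=> Fh; pose B : 'M[K]_3 := \matrix_(i, j) (F^`M(i))@_U_(j).
have dF i : F^`M(i) \is 1.-homog.
  apply/dhomogP => m; rewrite mcoeff_msupp mcoeff_mderiv => mF.
  have : F@_(m + U_(i)) != 0 by apply: contraNneq mF => ->; rewrite mul0rn.
  by rewrite -mcoeff_msupp => /(dhomog_mf Fh) /=; rewrite mdegD mdeg1 addn1 => -[].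
have sB : B^T = B.
  by apply/matrixP => i j; rewrite !mxE !mcoeff_mderiv addmC !mnm1E eq_sym.
have BE u v : bilin B u v = \sum_(i < 3) (F^`M(i)).@[u 0] * v 0 i.
  rewrite bilinE; apply: eq_bigr => i _; congr (_ * _).
  rewrite (linear_form_meval _ (dF i)) mxE; apply: eq_bigr => j _.
  by rewrite -sB !mxE mulrC.
exists B; split=> // u; rewrite BE -mevalMn -(euler_homog Fh) raddf_sum.
by apply: eq_bigr => i _; rewrite /= mevalM mevalXU mulrC.
Qed.

Lemma tangent_line_vector (F : S) (B : 'M[K]_3) (P : ppoint K) (l : pline K) :
  (forall u v, bilin B u v = \sum_(i < 3) (F^`M(i)).@[u 0] * v 0 i) ->
  tangent_line F P l -> exists q : 'rV[K]_3, [/\ q != 0, F.@[q 0] = 0 &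
    forall v, v \in val l <-> bilin B q v = 0].
Proof.
move=> BE [FP Pl]; exists (vpick (val P)).
have q0 : vpick (val P) != 0.
  by rewrite vpick0; apply/eqP => P0; have := valP P; rewrite P0 dimv0.
split=> //; first by apply: FP; rewrite memv_pick.
by move=> v; rewrite BE; apply: Pl; rewrite ?memv_pick.
Qed.

(** If [p] and [q] were orthogonal, both lines would contain both points. Either [p] and [q] are
    proportional and have the same polar, or both lines are their span. *)
Lemma tangent_lines_polar_neq0 (B : 'M[K]_3) (l m : pline K) (p q : 'rV[K]_3) :
  B^T = B -> p != 0 -> q != 0 -> bilin B p p = 0 -> bilin B q q = 0 ->
  (forall v, v \in val l <-> bilin B p v = 0) ->
  (forall v, v \in val m <-> bilin B q v = 0) -> l <> m -> bilin B p q != 0.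
Proof.
move=> sB p0 q0 pp qq lE mE; apply: contra_notN => /eqP pq; apply/val_inj.
have pl : p \in val l by apply/lE.
have ql : q \in val l by apply/lE.
have pm : p \in val m by apply/mE; rewrite bilinC.
have qm : q \in val m by apply/mE.
have dl : \dim (val l) = 2%N by apply/eqP/(valP l).
have dm : \dim (val m) = 2%N by apply/eqP/(valP m).
case: (boolP (q \in <[p]>%VS)) => [/vlineP [c qE]|qp].
  have c0 : c != 0 by apply: contraNneq q0 => c0; rewrite qE c0 scale0r.
  have lm : (val l <= val m)%VS.
    by apply/subvP => v /lE pv; apply/mE; rewrite qE bilinZl pv mulr0.
  by apply/eqP; rewrite eqEdim lm dl dm.
have d2 : \dim (<[p]> + <[q]>)%VS = 2%N.
  rewrite dimv_disjoint_sum ?dim_vline ?p0 ?q0 //.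
  apply/eqP; rewrite -subv0; apply/subvP => v /memv_capP [vp /vlineP [c vq]].
  rewrite memv0 vq; case: (eqVneq c 0) => [->|c0]; first by rewrite scale0r.
  by move: vp; rewrite vq rpredZeq (negbTE c0) (negbTE qp).
have E (U : {vspace 'rV[K]_3}) : p \in U -> q \in U -> \dim U = 2%N ->
    (<[p]> + <[q]>)%VS = U.
  move=> pU qU dU; apply/eqP; rewrite eqEdim dU d2 leqnn andbT.
  by rewrite subv_add -!memvE pU.
by rewrite -(E _ pl ql dl) (E _ pm qm dm).
Qed.

(** The two families are merged into one, so that a single change of coordinates serves both and all
    parameters are distinct. *)
Lemma contact_lines_parametrization (F : S) (r s : nat)
    (l : 'I_r -> pline K) (m : 'I_s -> pline K) :
  F \is 2.-homog -> (2 <= r)%N -> (2 <= s)%N ->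
  contact_lines F l -> contact_lines F m ->
  injective l -> injective m -> (forall i j, l i <> m j) ->
  exists (M : 'M[K]_3) (t : 'I_r -> K) (u : 'I_s -> K),
    [/\ M \in unitmx, injective t, injective u, (forall i j, u i <> t j) &
      (forall i v, v \in val (l i) <->
        (v *m M) 0 0 * t i ^+ 2 - (v *m M) 0 1 * t i + (v *m M) 0 2%:R = 0) /\
      (forall i v, v \in val (m i) <->
        (v *m M) 0 0 * u i ^+ 2 - (v *m M) 0 1 * u i + (v *m M) 0 2%:R = 0)].
Proof.
move=> Fh r2 s2 [p [_ lp]] [p' [_ mp]] lI mI lm.
have [B [sB BE BF]] := polar_form Fh.
pose L (k : 'I_r + 'I_s) := match k with inl i => l i | inr j => m j end.
have LI : injective L.
  by case=> [i|i] [j|j] /=; [move/lI ->|move/lm|move/esym/lm|move/mI ->].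
have /choice [q qP] : forall k, exists q : 'rV[K]_3, [/\ q != 0, F.@[q 0] = 0 &
    forall v, v \in val (L k) <-> bilin B q v = 0].
  by case=> i; apply: tangent_line_vector BE _; [apply: lp|apply: mp].
have qq k : bilin B (q k) (q k) = 0 by have [_ Fq _] := qP k; rewrite BF Fq mul0rn.
have qn k k' : k != k' -> bilin B (q k) (q k') != 0.
  have [q0 _ qE] := qP k; have [q'0 _ q'E] := qP k'.
  move=> kk'; apply: (tangent_lines_polar_neq0 sB q0 q'0 _ _ qE q'E) => //.
  by move/LI; apply/eqP.
have r0 : (0 < r)%N by apply: ltnW.
have s0 : (0 < s)%N by apply: ltnW.
(* The three base points come from two lines of the first family and one of the second. *)
have [//|//|//|M [tau [Mu tI tE]]] := @tangent_parametrization _ _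
  (inl (Ordinal r0) : 'I_r + 'I_s) (inl (Ordinal r2)) (inr (Ordinal s0)) B q _ _ _ sB qq qn.
exists M, (tau \o inl), (tau \o inr); split=> //.
- by move=> i j /tI [].
- by move=> i j /tI [].
- by move=> i j /tI.
by split=> i v; rewrite -tE; [have [_ _] := qP (inl i)|have [_ _] := qP (inr i)]; apply.
Qed.

(* In the coordinates v *m M, the tangent with parameter t is x0 t^2 - x1 t + x2 = 0. *)
Definition tangent_meet (M : 'M[K]_3) (x y : K) : 'rV[K]_3 :=
  vec3 1 (x + y) (x * y) *m invmx M.

(** A point on the tangents with parameters t_i and t_j has a quadratic with these two roots, so by
    Vieta's formulas it is (1 : t_i + t_j : t_i t_j). *)
Lemma star_vanishingP (M : 'M[K]_3) r (l : 'I_r -> pline K) (t : 'I_r -> K) (f : S) d :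
  M \in unitmx -> injective t ->
  (forall i v, v \in val (l i) <->
    (v *m M) 0 0 * t i ^+ 2 - (v *m M) 0 1 * t i + (v *m M) 0 2%:R = 0) ->
  f \is d.-homog ->
  (forall P, star_configuration l P -> vanishes_at f P) <->
  (forall i j : 'I_r, (i < j)%N -> f.@[tangent_meet M (t i) (t j) 0] = 0).
Proof.
move=> Mu tI lE fh.
have meetE (i j : 'I_r) : (i < j)%N ->
    (val (l i) :&: val (l j))%VS = <[tangent_meet M (t i) (t j)]>%VS.
  move=> ij; have tij : t i - t j != 0.
    by rewrite subr_eq0; apply: contraTneq ij => /tI ->; rewrite ltnn.
  apply/vspaceP => v; apply/memv_capP/vlineP.
    case=> /lE; set x := v *m M => vi /lE; rewrite -/x => vj; exists (x 0 0).
    have x1 : x 0 1 = x 0 0 * (t i + t j).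
      (* The difference of the two tangent equations is divisible by t_i - t_j. *)
      have e := congr2 (fun y z => y - z) vi vj; rewrite subrr /= in e.
      apply: (mulIf tij); apply/eqP; rewrite -subr_eq0 -[X in _ == X]oppr0 -e.
      by apply/eqP; ring.
    have x2 : x 0 2%:R = x 0 0 * (t i * t j).
      by apply/eqP; rewrite -subr_eq0; apply/eqP; rewrite -[RHS]vi x1; ring.
    rewrite -[v](mulmxK Mu) -/x [x]vec3_eta x1 x2 /tangent_meet scalemxAl.
    by congr (_ *m _); apply/rowP => k; rewrite !mxE; do 2?case: ifP => _; rewrite ?mulr1.
  case=> c ->; have E k : (c *: tangent_meet M (t i) (t j) *m M) 0 k
      = c * vec3 1 (t i + t j) (t i * t j) 0 k.
    by rewrite -scalemxAl mulmxKV // mxE.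
  by split; apply/lE; rewrite !E !vec3E; ring.
have dimw x y : \dim <[tangent_meet M x y]>%VS == 1%N.
  rewrite dim_vline eqb1; apply/eqP => w0; have := congr1 (mulmx^~ M) w0.
  rewrite mulmxKV // mul0mx => /rowP /(_ 0); rewrite !mxE => /eqP.
  by rewrite oner_eq0.
split=> [H i j ij|H P [i [j [ij PE]]]].
  pose P : ppoint K :=
    exist (fun U : {vspace 'rV[K]_3} => is_true (\dim U == 1%N)) _ (dimw (t i) (t j)).
  apply/(@vanishes_at_line _ f d P _ fh) => //; apply: H; exists i, j.
  by split=> //; rewrite meetE.
apply/(vanishes_at_line fh); first by rewrite PE meetE.
exact: H.
Qed.

End ContactStars.

(** * Comparison of graded pieces *)

Section GradedPieces.
Variable K : fieldType.
Local Notation S := {mpoly K[3]}.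

(** Both maps restrict to injective endomorphisms of the space of forms of degree [d], and they
    carry the two graded pieces onto the same set, described by [C]. *)
Lemma dim_graded_piece_eq (d : nat) (phi psi : S -> S) (C : S -> Prop) (I J : set S) :
  linear phi -> linear psi ->
  (forall f, f \is d.-homog -> phi f \is d.-homog) ->
  (forall f, f \is d.-homog -> psi f \is d.-homog) ->
  (forall f, f \is d.-homog -> phi f = 0 -> f = 0) ->
  (forall f, f \is d.-homog -> psi f = 0 -> f = 0) ->
  is_ideal I -> is_ideal J ->
  (forall f, f \is d.-homog -> I f <-> C (phi f)) ->
  (forall f, f \is d.-homog -> J f <-> C (psi f)) ->
  \dim (graded_piece I d) = \dim (graded_piece J d).
Proof.
move=> phiL psiL phiH psiH phi0 psi0 II IJ IC JC.
pose lift (h : S -> S) (hH : forall f, f \is d.-homog -> h f \is d.-homog) (f : dhomog 3 K d) :=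
  DHomog (hH f (dhomog_is_dhomog f)).
have liftL (h : S -> S) hH : linear h -> linear (@lift h hH).
  by move=> hL c f g; apply: val_inj; rewrite /= hL.
have liftI (h : S -> S) hH : linear h -> (forall f, f \is d.-homog -> h f = 0 -> f = 0) ->
    injective (@lift h hH).
  move=> hL h0 f g /(congr1 val) /= fg; apply: val_inj; apply/eqP; rewrite -subr_eq0.
  apply/eqP/h0; first by rewrite rpredB ?dhomog_is_dhomog.
  by rewrite addrC -scaleN1r hL fg scaleN1r addrC subrr.
pose F : {linear dhomog 3 K d -> dhomog 3 K d} := HB.pack (@lift phi phiH)
  (GRing.isLinear.Build _ _ _ _ _ (liftL phi phiH phiL)).
pose G : {linear dhomog 3 K d -> dhomog 3 K d} := HB.pack (@lift psi psiH)
  (GRing.isLinear.Build _ _ _ _ _ (liftL psi psiH psiL)).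
apply: (@dim_eq_of_injective_maps _ _ F G (fun f => C (val f))).
- exact: liftI.
- exact: liftI.
- by move=> f; rewrite graded_pieceP // IC ?dhomog_is_dhomog.
- by move=> f; rewrite graded_pieceP // JC ?dhomog_is_dhomog.
Qed.

End GradedPieces.

(** * Choice of coordinates and of interpolation nodes *)

Section Coordinates.
Variable K : numClosedFieldType.
Local Notation S := {mpoly K[3]}.

Lemma exists_basis_at_points (P Q : ppoint K) : P <> Q ->
  exists E : 'M[K]_3, [/\ E \in unitmx, val P = <[row 0%R E]>%VS & val Q = <[row 1%R E]>%VS].
Proof.
move=> PQ.
have lineE (X : ppoint K) : vpick (val X) != 0 /\ val X = <[vpick (val X)]>%VS.
  have X0 : vpick (val X) != 0.
    by rewrite vpick0; apply/eqP => X0; have := valP X; rewrite X0 dimv0.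
  split=> //; apply/esym/eqP; rewrite eqEdim -memvE memv_pick dim_vline X0.
  by rewrite (eqP (valP X)).
have [p0 pE] := lineE P; have [q0 qE] := lineE Q.
set p := vpick (val P) in p0 pE; set q := vpick (val Q) in q0 qE.
have qp : q \notin <[p]>%VS.
  apply/negP => qp; apply: PQ; apply: val_inj; apply/esym/eqP.
  by rewrite eqEdim qE pE -memvE qp !dim_vline p0 q0.
have [w wpq] : exists w, w \notin (<[p]> + <[q]>)%VS.
  apply: contrapT => /forallNP H.
  have : (fullv <= <[p]> + <[q]>)%VS.
    by apply/subvP => w _; have := H w; move/negP; rewrite negbK.
  move/dimvS; rewrite dimvf /dim /= => le3.
  have := leq_trans le3 (dimv_add_leqif _ _).1.
  by rewrite !dim_vline p0 q0.
exists (\matrix_(i < 3) (if i == 0 then p else if i == 1 then q else w)).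
split; rewrite ?rowK //= -row_free_unit; apply: inj_row_free => y.
rewrite mulmx_sum_row big_ord3 !rowK /= => /eqP yE.
have memZ (U : {vspace 'rV[K]_3}) (a : K) v : v \notin U -> a *: v \in U -> a = 0.
  by move=> vU; rewrite rpredZeq (negbTE vU) orbF => /eqP.
have y2 : y 0 2%:R = 0.
  apply: (memZ _ _ _ wpq); move: yE; rewrite addrC addr_eq0 => /eqP ->.
  by rewrite rpredN memv_add ?memvZ ?memv_line.
have y1 : y 0 1 = 0.
  apply: (memZ _ _ _ qp); move: yE; rewrite y2 scale0r addr0 addrC addr_eq0 => /eqP ->.
  by rewrite rpredN memvZ ?memv_line.
have y0 : y 0 0 = 0.
  move: yE; rewrite y1 y2 !scale0r !addr0 scaler_eq0 (negbTE p0) orbF.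
  by move/eqP.
by rewrite [y]vec3_eta y0 y1 y2; apply/rowP => k; rewrite !mxE; do 2?case: ifP.
Qed.

(** Newton bases are built on infinite sequences. The two families are continued by even and by odd
    terms of one fresh sequence, which keeps them disjoint. *)
Lemma exists_disjoint_sequences r s (t : 'I_r -> K) (u : 'I_s -> K) :
  injective t -> injective u -> (forall i j, u i <> t j) ->
  exists t' u' : nat -> K, [/\ injective t', injective u',
    forall i j, u' i <> t' j,
    forall i : 'I_r, t' i = t i & forall i : 'I_s, u' i = u i].
Proof.
move=> tI uI ut.
pose L (k : 'I_r + 'I_s) := match k with inl i => t i | inr j => u j end.
have [z [zI zL]] := exists_fresh L.
pose ext n (v : 'I_n -> K) (o : nat -> nat) k :=
  if insub k is Some i then v i else z (o k).
have extE n (v : 'I_n -> K) o (i : 'I_n) : ext n v o i = v i by rewrite /ext valK.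
have extI n (v : 'I_n -> K) o : injective v -> injective o ->
    (forall i k, v i != z k) -> injective (ext n v o).
  move=> vI oI vz i j; rewrite /ext.
  case: insubP => [i' _ <-|_]; case: insubP => [j' _ <-|_].
  - by move/vI ->.
  - by move/eqP; rewrite (negbTE (vz _ _)).
  - by move/esym/eqP; rewrite (negbTE (vz _ _)).
  - by move/zI/oI.
exists (ext r t double), (ext s u (fun k => k.*2.+1)); split; try exact: extE.
- by apply: extI (fun i => zL (inl i)) => //; apply: double_inj.
- by apply: extI (fun i => zL (inr i)) => // i j [] /double_inj.
move=> i j; rewrite /ext.
case: insubP => [i' _ _|_]; case: insubP => [j' _ _|_].
- exact: ut.
- by apply/eqP/(zL (inr i')).
- by apply/eqP; rewrite eq_sym; apply/(zL (inl j')).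
- by move/zI => e; have := congr1 odd e; rewrite /= !odd_double.
Qed.

Lemma tangent_meetC (M : 'M[K]_3) x y : tangent_meet M x y = tangent_meet M y x.
Proof. by rewrite /tangent_meet addrC mulrC. Qed.

(** Once one tangent is fixed, the other parameter moves the intersection point along a line; this
    bounds the degree of [f] there. *)
Lemma meval_pencil_poly (f : S) d (a b : 'rV[K]_3) : f \is d.-homog ->
  exists2 h : {poly K}, (size h <= d.+1)%N & forall x, f.@[(a + x *: b) 0] = h.[x].
Proof.
move=> fh.
exists (\sum_(m <- msupp f) f@_m *: \prod_i ((a 0 i)%:P + (b 0 i)%:P * 'X) ^+ m i).
  rewrite big_seq; apply: (leq_trans (size_sum _ _ _)).
  apply/bigmax_leqP_seq => m mf _; apply: (leq_trans (size_scale_leq _ _)).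
  rewrite -(dhomog_mf fh mf) /= mdegE; elim/big_ind2: _ => [|n p n' p' sp sp'|i _].
  - by rewrite size_poly1.
  - apply: (leq_trans (size_polyMleq _ _)).
    by move: sp sp'; move: (size p) (size p') => x y; lia.
  - apply: (leq_trans (size_poly_exp_leq _ _)); rewrite ltnS -[X in (_ <= X)%N]mul1n.
    rewrite leq_mul2r -subn1 leq_subLR; apply/orP; right.
    apply: (leq_trans (size_polyD _ _)); rewrite geq_max (leq_trans (size_polyC_leq1 _)) //=.
    by apply: (leq_trans (size_polyMleq _ _)); rewrite size_polyX addn2 /= ltnS size_polyC_leq1.
move=> x; rewrite mevalE horner_sum; apply: eq_bigr => m _.
rewrite hornerZ horner_prod; congr (_ * _); apply: eq_bigr => i _.
by rewrite horner_exp hornerD hornerM !hornerC hornerX !mxE mulrC.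
Qed.

End Coordinates.

(** * Alternating coordinates of a form and the star conditions *)

Section StarCoordinates.
Variable K : numClosedFieldType.
Local Notation S := {mpoly K[3]}.
Variables (d : nat) (M : 'M[K]_3) (u t : nat -> K).
Hypotheses (Mu : M \in unitmx) (uI : injective u) (tI : injective t).
Hypothesis (ut : forall i j, u i <> t j).

(* The form f as a symmetric function of the two tangents through a point,
   made antisymmetric by the factor x - y, which also removes the conditions
   on the diagonal of a grid. *)
Definition alt_pullback (f : S) (x y : K) : K := (x - y) * f.@[tangent_meet M x y 0].

Lemma alt_pullbackC f x y : alt_pullback f x y = - alt_pullback f y x.
Proof. by rewrite /alt_pullback tangent_meetC -mulNr opprB. Qed.

(** For fixed [y] the point (1, x + y, x y) is (1, y, 0) + x (0, 1, y), and the factor x - y raises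
    the degree to d + 1. *)
Lemma alt_pullback_poly f y : f \is d.-homog ->
  exists2 h : {poly K}, (size h <= d.+2)%N & forall x, alt_pullback f x y = h.[x].
Proof.
move=> fh; have [h sh hE] := meval_pencil_poly
  (vec3 1 y 0 *m invmx M) (vec3 0 1 y *m invmx M) fh.
exists (('X - y%:P) * h).
  by rewrite (leq_trans (size_polyMleq _ _)) // size_XsubC.
move=> x; rewrite hornerM hornerXsubC -hE /alt_pullback; congr (_ * _).
apply: meval_eq => i; rewrite scalemxAl -mulmxDl; congr ((_ *m _) _ _).
by apply/rowP => k; rewrite !mxE; do 2?case: ifP => _; ring.
Qed.

Lemma alt_pullback_poly_r f x : f \is d.-homog ->
  exists2 h : {poly K}, (size h <= d.+2)%N & forall y, alt_pullback f x y = h.[y].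
Proof.
move=> fh; have [h sh hE] := alt_pullback_poly x fh.
exists (- h); first by rewrite size_polyN.
by move=> y; rewrite alt_pullbackC hE hornerN.
Qed.

(** Natural indices allow the reversal from p to d + 1 - p; they are meaningful only up to d + 1,
    because of [inord]. *)
Definition alt_coord (f : S) (p q : nat) : K :=
  newton_coord u t d.+1 (alt_pullback f) (inord p) (inord q).

Lemma alt_pullbackE f x y : f \is d.-homog -> alt_pullback f x y =
  \sum_(p < d.+2) \sum_(q < d.+2)
     alt_coord f p q * (newton u t d.+1 p).[x] * (newton u t d.+1 q).[y].
Proof.
move=> fh; rewrite (newton_coordE (e := d.+1) uI ut).
- by apply: eq_bigr => p _; apply: eq_bigr => q _; rewrite /alt_coord !inord_val.
- by move=> y'; apply: alt_pullback_poly.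
- by move=> x'; apply: alt_pullback_poly_r.
Qed.

(** The matrix of grid values is antisymmetric, and a congruence preserves this. *)
Lemma alt_coordC f p q : alt_coord f p q = - alt_coord f q p.
Proof.
rewrite /alt_coord; move: (inord p) (inord q) => i j.
rewrite /newton_coord; set W := invmx _; set G := \matrix_(k, l) _.
have GT : G = - G^T by apply/matrixP => k l; rewrite !mxE alt_pullbackC.
rewrite {1}GT mulmxN mulNmx mxE; congr (- _).
rewrite (_ : W *m G^T *m W^T = (W *m G *m W^T)^T) ?mxE //.
by rewrite !trmx_mul trmxK mulmxA.
Qed.

Lemma alt_coord_linear p q : linear_for *%R (fun f => alt_coord f p q).
Proof.
move=> c f g; rewrite /alt_coord /newton_coord.
have -> : (\matrix_(k < d.+2, l < d.+2) alt_pullback (c *: f + g) (u k) (u l)) =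
    c *: (\matrix_(k < d.+2, l < d.+2) alt_pullback f (u k) (u l)) +
    (\matrix_(k < d.+2, l < d.+2) alt_pullback g (u k) (u l)).
  by apply/matrixP => k l; rewrite !mxE /alt_pullback mevalD mevalZ; ring.
by rewrite mulmxDr mulmxDl -scalemxAr -scalemxAl !mxE.
Qed.

(** By antisymmetry all coordinates vanish, so [f] vanishes wherever two distinct tangents meet.
    Over a closed field these points include all (1, T, z) with nonzero discriminant T^2 - 4 z. *)
Lemma alt_coord_eq0 f : f \is d.-homog ->
  (forall p q, (p < q)%N -> (q <= d.+1)%N -> alt_coord f p q = 0) -> f = 0.
Proof.
move=> fh f0.
have diag p : alt_coord f p p = 0.
  have /eqP := alt_coordC f p p; rewrite -addr_eq0 -mulr2n mulrn_eq0 /=.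
  by move/eqP.
have c0 p q : (p <= d.+1)%N -> (q <= d.+1)%N -> alt_coord f p q = 0.
  move=> pd qd; case: (ltngtP p q) => [pq|qp|<-]; [exact: f0| |exact: diag].
  by rewrite alt_coordC f0 ?oppr0.
have fxy x y : x != y -> f.@[tangent_meet M x y 0] = 0.
  move=> xy; have : alt_pullback f x y = 0.
    rewrite alt_pullbackE // big1 // => p _; rewrite big1 // => q _.
    by rewrite c0 ?mul0r // -ltnS.
  by move/eqP; rewrite mulf_eq0 subr_eq0 (negbTE xy) => /eqP.
have -> : f = lin_subst (invmx (invmx M)) (lin_subst (invmx M) f).
  by rewrite (lin_substK _ fh) ?unitmx_inv.
suff -> : lin_subst (invmx M) f = 0 by rewrite /lin_subst raddf0.
(* The discriminant along the Kronecker curve; it is a nonzero polynomial because the exponents 2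
   and d + 3 differ. *)
pose q : {poly K} := 'X^2 - 4%:R *: 'X^(d + 3).
apply: (@homog_eq0_of_curve _ _ d q); first exact: lin_subst_homog.
  apply/eqP => /(congr1 (fun p : {poly K} => p`_2)).
  rewrite coef0 coefB coefZ !coefXn eqxx addn3 /= mulr0 subr0 => /eqP.
  by rewrite oner_eq0.
move=> T; rewrite hornerD hornerN hornerZ !hornerXn => qT.
(* The parameters (T + D) / 2 and (T - D) / 2 have sum T and product [z], and they differ by [D]. *)
set z := T ^+ (d + 3) in qT *; pose D := sqrtC (T ^+ 2 - 4%:R * z).
have D2 : D ^+ 2 = T ^+ 2 - 4%:R * z by rewrite sqrtCK.
have D0 : D != 0 by rewrite sqrtC_eq0.
have := fxy ((T + D) / 2) ((T - D) / 2); rewrite meval_lin_subst /tangent_meet.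
have -> : (T + D) / 2 + (T - D) / 2 = T by field.
have -> : (T + D) / 2 * ((T - D) / 2) = z.
  by transitivity ((T ^+ 2 - D ^+ 2) / 4%:R); [field|rewrite D2; field].
apply; rewrite -subr_eq0 (_ : _ - _ = D) //; by field.
Qed.

Lemma alt_coord_grid_u f s : f \is d.-homog ->
  (forall k l, (k < s)%N -> (l < s)%N -> alt_pullback f (u k) (u l) = 0) <->
  (forall p q, (p < s)%N -> (q < s)%N -> (p <= d.+1)%N -> (q <= d.+1)%N ->
     alt_coord f p q = 0).
Proof.
move=> fh; rewrite -(newton_grid_eq0 d.+1 uI ut).
by split=> H k l ks ls; have := H k l ks ls; rewrite alt_pullbackE.
Qed.

Lemma alt_coord_grid_t f r : f \is d.-homog ->
  (forall k l, (k < r)%N -> (l < r)%N -> alt_pullback f (t k) (t l) = 0) <->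
  (forall p q, (p < r)%N -> (q < r)%N -> (p <= d.+1)%N -> (q <= d.+1)%N ->
     alt_coord f (d.+1 - p) (d.+1 - q) = 0).
Proof.
move=> fh; have tu i j : t i <> u j by move/esym/ut.
rewrite -(newton_grid_eq0 d.+1 tI tu (fun p q => alt_coord f (d.+1 - p) (d.+1 - q))).
have E k l : alt_pullback f (t k) (t l) = \sum_(p < d.+2) \sum_(q < d.+2)
    alt_coord f (d.+1 - p) (d.+1 - q) * (newton t u d.+1 p).[t k]
      * (newton t u d.+1 q).[t l].
  rewrite alt_pullbackE // (reindex_inj rev_ord_inj); apply: eq_bigr => p _.
  rewrite (reindex_inj rev_ord_inj); apply: eq_bigr => q _ /=.
  by rewrite !subSS !newton_rev // -ltnS.
by split=> H k l kr lr; have := H k l kr lr; rewrite E.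
Qed.

(** Off the diagonal the factor x - y is nonzero, and antisymmetry covers the pairs with k > l. *)
Lemma star_grid_vanishing f r (v : nat -> K) : injective v ->
  (forall i j : 'I_r, (i < j)%N -> f.@[tangent_meet M (v i) (v j) 0] = 0) <->
  (forall k l, (k < r)%N -> (l < r)%N -> alt_pullback f (v k) (v l) = 0).
Proof.
move=> vI; split=> [H k l kr lr|H i j ij].
  wlog kl : k l kr lr / (k < l)%N.
    move=> W; case: (ltngtP k l) => [kl|lk|<-]; first exact: W.
      by rewrite alt_pullbackC W ?oppr0.
    by rewrite /alt_pullback subrr mul0r.
  by rewrite /alt_pullback (H (Ordinal kr) (Ordinal lr)) ?mulr0.
have /eqP := H i j (ltn_ord i) (ltn_ord j); rewrite mulf_eq0 subr_eq0.
by case: eqP ij => [/vI ->|_ _ /eqP //]; rewrite ltnn.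
Qed.

(* The monomial X^a Y^b Z^c of degree d stands for the pair (a, d + 1 - b). *)
Definition alt_form (f : S) : S :=
  \sum_(m : 'X_{1..3 < d.+1})
    (if mdeg m == d then alt_coord f (m 0%R) (d.+1 - m 1%R) else 0) *: 'X_[m].

Lemma mcoeff_alt_form f (m : 'X_{1..3}) : mdeg m = d ->
  (alt_form f)@_m = alt_coord f (m 0%R) (d.+1 - m 1%R).
Proof.
move=> md; rewrite /alt_form (mcoeff_mpoly
  (fun m => if mdeg m == d then alt_coord f (m 0%R) (d.+1 - m 1%R) else 0)).
  by rewrite md eqxx.
by rewrite md.
Qed.

Lemma alt_form_homog f : alt_form f \is d.-homog.
Proof.
apply: rpred_sum => m _; case: eqP => [md|_]; last by rewrite scale0r rpred0.
by apply: rpredZ; rewrite dhomogX /= md.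
Qed.

Lemma alt_form_linear : linear alt_form.
Proof.
move=> c f g; rewrite /alt_form scaler_sumr -big_split; apply: eq_bigr => m _ /=.
case: eqP => _; last by rewrite !scale0r scaler0 addr0.
by rewrite alt_coord_linear scalerDl scalerA.
Qed.

(** The pairs p < q <= d + 1 correspond bijectively to the exponents (p, d + 1 - q, q - p - 1) of
    sum [d]. The predicate [C] tells which monomials are allowed. *)
Lemma alt_form_suppP f (C : nat -> nat -> bool) :
  (forall m, m \in msupp (alt_form f) -> C (m 0%R) (m 1%R)) <->
  (forall p q, (p < q)%N -> (q <= d.+1)%N -> ~~ C p (d.+1 - q)%N ->
     alt_coord f p q = 0).
Proof.
split=> [H p q pq qd nC|H m mf].
  pose m := [multinom if (i : 'I_3) == 0%R then p else if i == 1%R then (d.+1 - q)%N else (q - p).-1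
     | i < 3].
  have m0 : m 0 = p by rewrite mnmE.
  have m1 : m 1 = (d.+1 - q)%N by rewrite mnmE.
  have m2 : m 2%:R = (q - p).-1 by rewrite mnmE.
  have md : mdeg m = d by rewrite mdegE big_ord3 m0 m1 m2 /=; clear -pq qd; lia.
  have := mcoeff_alt_form f md; rewrite m0 m1 subKn // => <-.
  by apply: memN_msupp_eq0; apply: contra nC => /H; rewrite m0 m1.
have md : mdeg m = d := dhomog_mf (alt_form_homog f) mf.
apply: contraTT mf => nC; rewrite -mcoeff_eq0 mcoeff_alt_form //.
have mE : (m 0%R + m 1%R + m 2%:R%R = d)%N by rewrite -md mdegE big_ord3.
apply/eqP/H; [|exact: leq_subr|]; last first.
  by rewrite subKn //; move: (m 0%R) (m 1%R) (m 2%:R%R) mE => a b c; clear; lia.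
by move: (m 0%R) (m 1%R) (m 2%:R%R) mE => a b c; clear; lia.
Qed.

Lemma alt_form_eq0 f : f \is d.-homog -> alt_form f = 0 -> f = 0.
Proof.
move=> fh f0; apply: alt_coord_eq0 => // p q pq qd.
(* With no monomial allowed, the support condition says that every coordinate vanishes. *)
by apply: (alt_form_suppP f (fun _ _ => false)).1 => // m; rewrite f0 msupp0.
Qed.

(** For p < q, both indices are below [s] exactly when q is, and both reversed indices are below [r]
    exactly when d + 1 - p is. In exponents these are the failures of the two inequalities. *)
Lemma star_alt_form f r s : f \is d.-homog ->
  (forall i j : 'I_r, (i < j)%N -> f.@[tangent_meet M (t i) (t j) 0] = 0) /\
  (forall i j : 'I_s, (i < j)%N -> f.@[tangent_meet M (u i) (u j) 0] = 0) <->
  (forall m, m \in msupp (alt_form f) -> (m 0%R + r <= d.+1)%N && (m 1%R + s <= d.+1)%N).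
Proof.
move=> fh; rewrite (alt_form_suppP f (fun a b => (a + r <= d.+1) && (b + s <= d.+1))%N).
rewrite (star_grid_vanishing f r tI) (star_grid_vanishing f s uI).
rewrite alt_coord_grid_t // alt_coord_grid_u //.
split=> [[Ht Hu] p q pq qd|H].
  rewrite negb_and -!ltnNge => /orP [pr|qs].
    have pd : (p <= d.+1)%N by apply: leq_trans qd; apply: ltnW.
    by rewrite -(subKn pd) -(subKn qd) Ht //; clear -pq qd pr; lia.
  by apply: Hu => //; clear -pq qd qs; lia.
(* A grid condition concerns all ordered pairs; antisymmetry leaves those with p < q. *)
have zero p q : (p <= d.+1)%N -> (q <= d.+1)%N ->
    ((p < q)%N -> alt_coord f p q = 0) -> ((q < p)%N -> alt_coord f q p = 0) ->
    alt_coord f p q = 0.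
  move=> pd qd pq qp; case: (ltngtP p q) => [//|/qp e|<-].
    by rewrite alt_coordC e oppr0.
  have /eqP := alt_coordC f p p; rewrite -addr_eq0 -mulr2n mulrn_eq0 /=.
  by move/eqP.
split=> p q pr qr pd qd; apply: zero; rewrite ?leq_subr // => pq;
  apply: H; rewrite ?leq_subr //; rewrite negb_and -!ltnNge; apply/orP.
- by left; clear -pr pd; lia.
- by left; clear -qr qd; lia.
- by right; clear -qr qd; lia.
- by right; clear -pr pd; lia.
Qed.

End StarCoordinates.

(** * Equality of the Hilbert functions *)

Lemma is_ideal_fat2 (K : fieldType) m (P : ppoint K) n (Q : ppoint K) :
  is_ideal (fat2_ideal m P n Q).
Proof. by apply: is_idealI; apply: is_ideal_gen. Qed.

(** With [P] and [Q] as the first two coordinate points, the fat point ideal and the star ideal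
    impose the same condition on the monomials of the transformed form. *)
Lemma dim_contact_stars_fat_points (K : numClosedFieldType) (F : {mpoly K[3]}) (r s : nat)
    (l : 'I_r -> pline K) (m : 'I_s -> pline K) (P Q : ppoint K) (d : nat) :
  F \is 2.-homog -> (2 <= r)%N -> (2 <= s)%N ->
  contact_lines F l -> contact_lines F m ->
  injective l -> injective m -> (forall i j, l i <> m j) -> P <> Q ->
  \dim (graded_piece (point_ideal (star_configuration l `|` star_configuration m)) d) =
  \dim (graded_piece (fat2_ideal r.-1 P s.-1 Q) d).
Proof.
move=> Fh r2 s2 Fl Fm lI mI lm PQ.
have [M [t [u [Mu tI uI ut [lE mE]]]]] :=
  contact_lines_parametrization Fh r2 s2 Fl Fm lI mI lm.
have [t' [u' [t'I u'I ut' tE uE]]] := exists_disjoint_sequences tI uI ut.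
have [E [Eu PE QE]] := exists_basis_at_points PQ.
apply: (dim_graded_piece_eq (phi := alt_form d M u' t') (psi := lin_subst E)
  (C := fun h => forall n, n \in msupp h -> (n 0%R + r <= d.+1)%N && (n 1%R + s <= d.+1)%N)).
- exact: alt_form_linear.
- exact: lin_subst_is_linear.
- by move=> f _; apply: alt_form_homog.
- by move=> f; apply: lin_subst_homog.
- by move=> f; apply: alt_form_eq0.
- by move=> f fh f0; rewrite -(lin_substK Eu fh) f0 /lin_subst raddf0.
- exact: is_ideal_gen.
- exact: is_ideal_fat2.
- move=> f fh; rewrite -(star_alt_form M u'I t'I ut' r s fh) (point_ideal_homogP _ fh).
  have := star_vanishingP Mu tI lE fh; have := star_vanishingP Mu uI mE fh.
  move=> um tl; split=> [H|[Ht Hu] X [|] XS].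
  + split=> i j ij; rewrite ?tE ?uE.
      by apply: tl.1 ij => X XS; apply: H; left.
    by apply: um.1 ij => X XS; apply: H; right.
  + by apply: tl.2 X XS => i j /Ht; rewrite !tE.
  + by apply: um.2 X XS => i j /Hu; rewrite !uE.
move=> f fh; have Eh := lin_subst_homog E fh.
(* The stars give a + r <= d + 1 because the alternating factor adds one degree; this is order at
   least r - 1 in degree [d], whence the multiplicities r - 1 and s - 1. *)
have ord1 n k : (0 < k)%N -> (n + k <= d.+1)%N = (n + k.-1 <= d)%N.
  by case: k => // k _; rewrite addnS.
split=> [[fP fQ] n nf|H].
  rewrite !ord1 ?(ltnW r2) ?(ltnW s2) // -(dhomog_mf Eh nf) /=.
  by rewrite ((fat_ideal_homogP _ Eu PE fh).1 fP n nf) ((fat_ideal_homogP _ Eu QE fh).1 fQ n nf).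
by split; [apply/(fat_ideal_homogP _ Eu PE fh)|apply/(fat_ideal_homogP _ Eu QE fh)] => n nf;
  have := H n nf; rewrite (dhomog_mf Eh nf) !ord1 ?(ltnW r2) ?(ltnW s2) // => /andP [].
Qed.

Theorem theorem4p3 (R : realType) (F : {mpoly R[i][3]}) (r s : nat)
    (l : 'I_r -> pline R[i]) (m : 'I_s -> pline R[i]) (P Q : ppoint R[i]) :
  irreducible_conic_form F ->
  (2 <= r)%N -> (2 <= s)%N ->
  contact_lines F l -> contact_lines F m ->
  injective l -> injective m -> (forall i j, l i <> m j) ->
  P <> Q ->
  forall t : nat,
    h_vector (point_ideal (star_configuration l `|` star_configuration m)) t =
    h_vector (fat2_ideal r.-1 P s.-1 Q) t.
Proof.
move=> [Fh _] r2 s2 Fl Fm lI mI lm PQ t.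
have H d : hilbert_function
    (point_ideal (star_configuration l `|` star_configuration m)) d =
    hilbert_function (fat2_ideal r.-1 P s.-1 Q) d.
  congr (_ - (_ : nat)%:Z).
  exact: dim_contact_stars_fat_points Fh r2 s2 Fl Fm lI mI lm PQ.
by rewrite /h_vector H; case: t => [//|t]; rewrite H.
Qed.
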